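(* Let $n \ge 4$ be an integer, consider the equation $n = k + p_k$ in the positive integer unknown $k$, and define the sequence $(k_j)_{j\ge 0}$ by \[ k_0 = \pi(n), \qquad k_{j+1} = \pi(n-k_j) \quad (j \ge 0). \] (It is known that this sequence eventually either becomes constant, equal to a fixed point $k^{*}$ with $\pi(n-k^* )=k^*$, or eventually alternates between two values $k'$ and $k'' = k'+1$.) Then: (i) If the sequence eventually becomes constant equal to $k^{*}$, then $k^{*}$ is the solution of the equation $n' = k + p_k$, where $n' = \max\{ j + p_j \le n : j \ge 1\}$. In particular, the equation $n = k + p_k$ has a solution if and only if $n' = n$, and in that case $k^{*}$ is the solution. (ii) If the sequence eventually alternates between $k'$ and $k'' = k'+1$, then the equation $n = k + p_k$ has no solution.
   Context: $\pi(x)$ denotes the number of primes less than or equal to $x$, and $p_k$ denotes the $k$th prime number ($p_1=2$). *)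

(* Defs.v *)
From mathcomp Require Import all_boot.

Set Implicit Arguments.
Unset Strict Implicit.
Unset Printing Implicit Defensive.

Definition prime_pi (x : nat) : nat := count prime (iota 1 x).

Lemma ex_next_prime (m : nat) : exists p, (m < p) && prime p.
Proof. by have [p m_lt_p p_pr] := prime_above m; exists p; rewrite m_lt_p. Qed.

Definition next_prime (m : nat) : nat := ex_minn (ex_next_prime m).

(* Indexed from 1 (nth_prime 1 = 2); nth_prime 0 = 0 is a junk value. *)
Definition nth_prime (k : nat) : nat := iter k next_prime 0.

Definition solves (n k : nat) : Prop := 0 < k /\ n = k + nth_prime k.

(* The truncated subtraction is exact, since prime_pi x <= x for all x. *)
Definition kseq (n j : nat) : nat :=
  iter j (fun k => prime_pi (n - k)) (prime_pi n).

Definition eventually_constant (s : nat -> nat) (a : nat) : Prop :=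
  exists J, forall j, J <= j -> s j = a.

Definition eventually_alternates (s : nat -> nat) (a b : nat) : Prop :=
  exists J, forall i, s (J + i.*2) = a /\ s (J + i.*2.+1) = b.

(* The bound j <= n loses nothing because j <= j + nth_prime j. The maximum is
   over a nonempty set as soon as 3 <= n (j = 1 qualifies). *)
Definition max_attained (n : nat) : nat :=
  \max_(1 <= j < n.+1 | j + nth_prime j <= n) (j + nth_prime j).

(* Main.v *)
Require Import Defs.
From mathcomp Require Import all_boot.

(** The map [k |-> prime_pi (n - k)] is antitone, and since [nth_prime] and
    [prime_pi] form a Galois connection, every solution of [n = k + nth_prime k]
    is one of its fixed points. A fixed point [k] satisfies
    [k + nth_prime k <= n < k.+1 + nth_prime k.+1], so it attains the maximum
    [max_attained n]. An antitone map exchanging [k'] and [k'.+1] has no fixed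
    point. *)

Lemma prime_piS x : prime_pi x.+1 = prime_pi x + prime x.+1.
Proof. by rewrite /prime_pi -{1}(addn1 x) iotaD count_cat /= add1n addn0. Qed.

Lemma leq_prime_pi : {homo prime_pi : x y / x <= y}.
Proof.
by apply: homo_leq => // [? ? ?|x]; [exact: leq_trans | rewrite prime_piS leq_addr].
Qed.

Lemma prime_pi_leq x : prime_pi x <= x.
Proof. by rewrite -[leqRHS](size_iota 1) count_size. Qed.

Lemma next_primeP m :
  [/\ m < next_prime m, prime (next_prime m)
    & forall p, m < p -> prime p -> next_prime m <= p].
Proof.
rewrite /next_prime; case: ex_minnP => p /andP[m_lt_p p_pr] p_min.
by split=> // q m_lt_q q_pr; apply: p_min; rewrite m_lt_q.
Qed.

(** No prime lies strictly between [m] and [next_prime m], so the count cannot grow there. *)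
Lemma prime_pi_lt_next_prime m x : x < next_prime m -> prime_pi x <= prime_pi m.
Proof.
have [_ _ p_min] := next_primeP m.
elim: x => [|x IHx] x_lt; first exact: leq_prime_pi.
have [/leq_prime_pi //|m_lt_x] := leqP x.+1 m.
rewrite prime_piS; case: (boolP (prime x.+1)) => [/(p_min _ m_lt_x)|_].
  by rewrite leqNgt x_lt.
by rewrite addn0 IHx // ltnW.
Qed.

Lemma prime_pi_next_prime m : prime_pi (next_prime m) = (prime_pi m).+1.
Proof.
have [] := next_primeP m; have := @prime_pi_lt_next_prime m.
case: (next_prime m) => // p pi_le m_lt p_pr _.
rewrite prime_piS p_pr addn1; congr _.+1; apply/eqP.
by rewrite eqn_leq pi_le //= leq_prime_pi.
Qed.

Lemma nth_primeK : cancel nth_prime prime_pi.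
Proof. by elim=> //= k IHk; rewrite prime_pi_next_prime IHk. Qed.

(** For the converse, [x] below the prime of index [k.+1] leaves [prime_pi x] at most [k]. The value
    [nth_prime 0 = 0] makes the case of index 0 trivial. *)
Lemma leq_nth_prime k x : (nth_prime k <= x) = (k <= prime_pi x).
Proof.
apply/idP/idP => [/leq_prime_pi|]; first by rewrite nth_primeK.
case: k => // k; apply: contraTT; rewrite -!ltnNge => /prime_pi_lt_next_prime.
by rewrite nth_primeK ltnS.
Qed.

Lemma addn_nth_prime_mono : {mono (fun k => k + nth_prime k) : j k / j <= k}.
Proof.
apply: leq_mono => j k j_lt_k; rewrite -addSn leq_add //.
by rewrite leq_nth_prime nth_primeK ltnW.
Qed.

Lemma solves_inj n j k : solves n j -> solves n k -> j = k.
Proof.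
by move=> [_ nj] [_ nk]; apply: (incn_inj addn_nth_prime_mono); rewrite -nj -nk.
Qed.

Lemma solves_fixed n k : solves n k -> prime_pi (n - k) = k.
Proof. by move=> [_ ->]; rewrite addKn nth_primeK. Qed.

Lemma max_attained_leq n : max_attained n <= n.
Proof. by apply/bigmax_leqP_seq. Qed.

Lemma leq_max_attained n k :
  0 < k -> k + nth_prime k <= n -> k + nth_prime k <= max_attained n.
Proof.
move=> k_gt0 k_le; apply: leq_bigmax_seq => //.
by rewrite mem_index_iota k_gt0 ltnS (leq_trans (leq_addr _ _) k_le).
Qed.

Lemma solves_max_attained n k : solves n k -> max_attained n = n.
Proof.
move=> [k_gt0 def_n]; apply/eqP; rewrite eqn_leq max_attained_leq /=.
by rewrite {1}def_n leq_max_attained // -def_n.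
Qed.

Lemma fixed_solves_max n k :
  1 < n -> prime_pi (n - k) = k -> solves (max_attained n) k.
Proof.
move=> n_gt1 fix_k.
(* The value 0 is excluded because [prime_pi n] is at least [prime_pi 2 = 1]. *)
have k_gt0 : 0 < k.
  case: k fix_k => //; rewrite subn0 => pi0.
  by have := leq_prime_pi _ _ n_gt1; rewrite pi0.
have k_le_n : k <= n by rewrite -fix_k (leq_trans (prime_pi_leq _)) ?leq_subr.
have sum_le : k + nth_prime k <= n.
  by rewrite -leq_subRL // leq_nth_prime fix_k.
split=> //; apply/eqP; rewrite eqn_leq leq_max_attained // andbT.
apply/bigmax_leqP_seq => j _ j_le.
rewrite addn_nth_prime_mono leqNgt; apply/negP => k_lt_j.
(* A larger admissible index [j] would force [k + nth_prime k.+1 <= j + nth_prime j <= n], hence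
   [k.+1 <= prime_pi (n - k) = k]. *)
have : nth_prime k.+1 <= n - k.
  rewrite leq_subRL //; apply: leq_trans j_le; rewrite leq_add ?(ltnW k_lt_j) //.
  by rewrite leq_nth_prime nth_primeK.
by rewrite leq_nth_prime fix_k ltnn.
Qed.

Theorem theorem2 (n : nat) (hn : 4 <= n) :
  (forall kstar : nat, eventually_constant (kseq n) kstar ->
     unique (solves (max_attained n)) kstar /\
     ((exists k, solves n k) <-> max_attained n = n) /\
     (max_attained n = n -> unique (solves n) kstar)) /\
  (forall k' : nat, eventually_alternates (kseq n) k' k'.+1 ->
     ~ exists k, solves n k).
Proof.
split=> [k [J kJ]|k' [J altJ] [k sol_k]].
  have sol_k : solves (max_attained n) k.
    apply: fixed_solves_max; first exact: ltnW (ltnW hn).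
    (* Equality of the terms at [J] and [J.+1] is the fixed-point equation. *)
    by rewrite -[RHS](kJ J.+1) //= -/(kseq n J) kJ.
  have uniq_k : unique (solves (max_attained n)) k.
    by split=> // j; apply: solves_inj.
  split=> //; split=> [|max_n]; last by rewrite -{1}max_n.
  by split=> [[j /solves_max_attained]|max_n] //; exists k; rewrite -max_n.
(* The terms at [J], [J.+1] and [J.+2] show that the map exchanges [k'] and [k'.+1]. *)
have [k'E k''E] := altJ 0; have [k'E2 _] := altJ 1.
move: k'E k''E k'E2; rewrite /= addn0 addn1 addn2 /= -/(kseq n J) => -> k''E.
rewrite k''E => k'E; have fix_k := solves_fixed _ _ sol_k.
(* Antitonicity sends [k <= k'] to [k'.+1 <= k], and [k'.+1 <= k] to [k <= k']; both are absurd. *)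
have [k_le|k_gt] := leqP k k'.
  have := leq_prime_pi _ _ (leq_sub2l n k_le).
  by rewrite k''E fix_k ltnNge k_le.
have := leq_prime_pi _ _ (leq_sub2l n k_gt).
by rewrite k'E fix_k leqNgt k_gt.
Qed.
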